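(* Let $A\subset\mathbb{R}^d$ be a closed Lipschitz domain. Then $A$ is locally WDC if and only if $A$ is a closed DC domain.
   Context: A real function on an open convex set of a finite-dimensional space is DC if it is a difference of two convex functions. For locally Lipschitz $f$, $\partial f(x)$ is the Clarke subgradient. A number $c$ is a weakly regular value of $f$ if whenever $x_i\to x$, $f(x_i)>c=f(x)$ and $u_i\in\partial f(x_i)$, then $\liminf_i|u_i|>0$. A set $A\subset\mathbb{R}^d$ is WDC if there is a DC function $f:\mathbb{R}^d\to[0,\infty)$ with $A=f^{-1}\{0\}$ and $0$ a weakly regular value of $f$; $A$ is locally WDC if for every $a\in A$ there is a WDC set agreeing with $A$ on an open neighbourhood of $a$. A closed set $A\subset\mathbb{R}^d$ is a closed Lipschitz domain (resp. closed DC domain) if for each $a\in\partial A$ there exist $r>0$, a $(d-1)$-dimensional linear subspace $W$, a unit vector $v\in W^\perp$ and a Lipschitz (resp. DC) function $\varphi:W\to\mathbb{R}$ such that $A\cap B(a,r)=\{w+tv:w\in W,\ t\le\varphi(w)\}\cap B(a,r)$. *)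

(* Defs.v *)
From HB Require Import structures.
From mathcomp Require Import all_boot all_order all_algebra.
From mathcomp Require Import all_classical all_reals all_analysis.
Set Implicit Arguments. Unset Strict Implicit. Unset Printing Implicit Defensive.
Import Order.TTheory GRing.Theory Num.Theory.
Import numFieldNormedType.Exports.
Local Open Scope classical_set_scope.
Local Open Scope ring_scope.

Section Defs.
Variables (R : realType) (d : nat).

Notation E := 'rV[R]_d.

Definition dotp (u v : E) : R := \sum_(i < d) u 0 i * v 0 i.
Definition enorm (x : E) : R := Num.sqrt (\sum_(i < d) x 0 i ^+ 2).

Definition eball (a : E) (r : R) : set E := [set x | enorm (x - a) < r].

Definition convex_on (S : set E) (g : E -> R) : Prop :=
  forall x y, S x -> S y -> forall t : R, 0 <= t <= 1 ->
    g (t *: x + (1 - t) *: y) <= t * g x + (1 - t) * g y.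

Definition DC_on (S : set E) (f : E -> R) : Prop :=
  exists g h : E -> R, [/\ convex_on S g, convex_on S h &
    forall x, S x -> f x = g x - h x].

Definition lipschitz_on (S : set E) (f : E -> R) : Prop :=
  exists L : R, forall x y, S x -> S y -> `|f x - f y| <= L * enorm (x - y).

(* Clarke subgradient: u \in \partial f(x) iff <u,v> <= f°(x;v) for all v,
   where f°(x;v) = limsup_{y -> x, t \downarrow 0} (f(y + t v) - f(y)) / t.
   The inequality <u,v> <= limsup is written out explicitly. *)
Definition clarke_subgrad (f : E -> R) (x u : E) : Prop :=
  forall v : E, forall eps delta : R, 0 < eps -> 0 < delta ->
    exists (y : E) (t : R), [/\ enorm (y - x) < delta, 0 < t, t < delta &
      dotp u v - eps < (f (y + t *: v) - f y) / t].

Definition weakly_regular_value (f : E -> R) (c : R) : Prop :=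
  forall (x : E) (xs us : nat -> E),
    xs @ \oo --> x ->
    f x = c ->
    (forall i, c < f (xs i)) ->
    (forall i, clarke_subgrad f (xs i) (us i)) ->
    exists2 e : R, 0 < e & \forall i \near \oo, e <= enorm (us i).

Definition WDC (A : set E) : Prop :=
  exists f : E -> R, [/\ DC_on setT f, (forall x, 0 <= f x),
    A = f @^-1` [set 0] & weakly_regular_value f 0].

Definition locally_WDC (A : set E) : Prop :=
  forall a, A a -> exists B : set E, WDC B /\
    exists U : set E, [/\ open U, U a & A `&` U = B `&` U].

Definition bdry (A : set E) : set E := closure A `\` interior A.

(* (d-1)-dimensional linear subspace W (as the row space of a d x d matrix),
   unit vector v in W^perp, and the subgraph {w + t v : w in W, t <= phi w}. *)
Definition subgraph (W : 'M[R]_d) (v : E) (phi : E -> R) : set E :=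
  [set x | exists (w : E) (t : R), [/\ (w <= W)%MS, t <= phi w & x = w + t *: v]].

Definition domain_chart (P : set E -> (E -> R) -> Prop) (A : set E) (a : E) : Prop :=
  exists (r : R) (W : 'M[R]_d) (v : E) (phi : E -> R),
    [/\ 0 < r, \rank W = d.-1,
        enorm v = 1 /\ (forall w : E, (w <= W)%MS -> dotp w v = 0),
        P [set w : E | (w <= W)%MS] phi &
        A `&` eball a r = subgraph W v phi `&` eball a r].

Definition closed_Lipschitz_domain (A : set E) : Prop :=
  closed A /\ forall a, bdry A a -> domain_chart lipschitz_on A a.

Definition closed_DC_domain (A : set E) : Prop :=
  closed A /\ forall a, bdry A a -> domain_chart DC_on A a.

End Defs.

(* Main.v *)
Require Import Defs.
From HB Require Import structures.
From mathcomp Require Import all_boot all_order all_algebra.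
From mathcomp Require Import all_classical all_reals all_analysis.
From mathcomp Require Import ring lra.
Set Implicit Arguments. Unset Strict Implicit. Unset Printing Implicit Defensive.
Import Order.TTheory GRing.Theory Num.Theory.
Import numFieldNormedType.Exports.
Local Open Scope classical_set_scope.
Local Open Scope ring_scope.

(* DC domain => WDC: [max(0, t - phi(w))] is DC, vanishes exactly on the subgraph
   [t <= phi(w)], and has slope [-1] in direction [-v] where it is positive.

   WDC => DC domain: let [A] be [t <= phi(w)] with [phi] Lipschitz, and let
   [f = g - h] with [g], [h] convex describe [A] near a boundary point. Weak
   regularity and a variational argument give [f >= const * dist(., A)], hence
   [f(w + t v) >= c (t - phi(w))] above the graph, while [f = 0] below it. As [h]
   is convex along [v], the convex function [t |-> g(w + t v)] has a kink of size at
   least [c] at [t = phi(w)]: its subdifferential there contains an interval of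
   length [c]. For two slopes [s < s'] in this interval,
   [phi(w) = (G_s(w) - G_s'(w)) / (s' - s)] where
   [G_s(w) = min_t (g(w + t v) - s t)] is convex in [w]. With finitely many slopes,
   [phi] is a continuous selection of finitely many DC functions, hence DC. *)

(** * Euclidean inner product and norm, compared with the sup-norm topology of row vectors *)

Section Euclid.
Variables (R : realType) (d : nat).
Notation E := 'rV[R]_d.
Implicit Types (x y z u v w : E).

Lemma dotpC u v : dotp u v = dotp v u.
Proof. by apply: eq_bigr => i _; rewrite mulrC. Qed.

Lemma dotpDl u v w : dotp (u + v) w = dotp u w + dotp v w.
Proof. by rewrite -big_split; apply: eq_bigr => i _ /=; rewrite mxE mulrDl. Qed.

Lemma dotpZl (a : R) u v : dotp (a *: u) v = a * dotp u v.
Proof. by rewrite mulr_sumr; apply: eq_bigr => i _; rewrite mxE mulrA. Qed.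

Lemma dotpNl u v : dotp (- u) v = - dotp u v.
Proof. by rewrite -scaleN1r dotpZl mulN1r. Qed.

Lemma dotpBl u v w : dotp (u - v) w = dotp u w - dotp v w.
Proof. by rewrite dotpDl dotpNl. Qed.

Lemma dotpDr u v w : dotp w (u + v) = dotp w u + dotp w v.
Proof. by rewrite dotpC dotpDl !(dotpC _ w). Qed.

Lemma dotpZr (a : R) u v : dotp u (a *: v) = a * dotp u v.
Proof. by rewrite dotpC dotpZl dotpC. Qed.

Lemma dotpNr u v : dotp u (- v) = - dotp u v.
Proof. by rewrite dotpC dotpNl dotpC. Qed.

Lemma dotpBr u v w : dotp w (u - v) = dotp w u - dotp w v.
Proof. by rewrite dotpDr dotpNr. Qed.

Lemma dotpp_ge0 u : 0 <= dotp u u.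
Proof. by apply: sumr_ge0 => i _; rewrite -expr2 sqr_ge0. Qed.

Lemma enormE u : enorm u = Num.sqrt (dotp u u).
Proof. by congr Num.sqrt; apply: eq_bigr => i _; rewrite expr2. Qed.

Lemma sqr_enorm u : enorm u ^+ 2 = dotp u u.
Proof. by rewrite enormE sqr_sqrtr // dotpp_ge0. Qed.

Lemma enorm_ge0 u : 0 <= enorm u.
Proof. by rewrite enormE sqrtr_ge0. Qed.

Lemma enormZ (a : R) u : enorm (a *: u) = `|a| * enorm u.
Proof.
rewrite !enormE dotpZl dotpZr mulrA -expr2 sqrtrM ?sqr_ge0 //.
by rewrite sqrtr_sqr.
Qed.

Lemma enormN u : enorm (- u) = enorm u.
Proof. by rewrite -scaleN1r enormZ normrN1 mul1r. Qed.

Lemma enorm0 : enorm (0 : E) = 0.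
Proof. by rewrite -(scale0r (0 : E)) enormZ normr0 mul0r. Qed.

Lemma enormC x y : enorm (x - y) = enorm (y - x).
Proof. by rewrite -opprB enormN. Qed.

Lemma coord_le_enorm u (i : 'I_d) : `|u 0 i| <= enorm u.
Proof.
rewrite -sqrtr_sqr ler_wsqrtr // (bigD1 i) //= lerDl.
by apply: sumr_ge0 => j _; rewrite sqr_ge0.
Qed.

Lemma enorm_eq0 u : enorm u = 0 -> u = 0.
Proof.
move=> u0; apply/rowP => i; rewrite mxE; apply/eqP.
by rewrite -normr_le0 -u0 coord_le_enorm.
Qed.

Lemma normr_le_enorm u : `|u| <= enorm u.
Proof.
rewrite [`|u|]mx_normrE; apply: bigmax_le; first exact: enorm_ge0.
by move=> [i j] _ /=; rewrite (ord1 i) coord_le_enorm.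
Qed.

(* Expand [0 <= | <v,v> u - <u,v> v |^2]. *)
Lemma cauchy_schwarz u v : `|dotp u v| <= enorm u * enorm v.
Proof.
have [v0|v0] := eqVneq (enorm v) 0.
  by rewrite (enorm_eq0 v0) dotpC -(scale0r u) dotpZl mul0r normr0 mulr_ge0 ?enorm_ge0.
have vgt0 : 0 < enorm v by rewrite lt_neqAle eq_sym v0 enorm_ge0.
rewrite -(@ler_pXn2r _ 2) ?nnegrE ?mulr_ge0 ?enorm_ge0 //.
rewrite real_normK ?num_real // exprMn !sqr_enorm.
have := dotpp_ge0 (dotp v v *: u - dotp u v *: v).
rewrite dotpBl !dotpBr !dotpZl !dotpZr (dotpC v u).
have : 0 < dotp v v by rewrite -sqr_enorm exprn_gt0.
move: (dotp u u) (dotp u v) (dotp v v) => a b c c0 H.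
rewrite -(ler_pM2l c0) -subr_ge0.
by move: H; congr (0 <= _); ring.
Qed.

Lemma ler_enormD u v : enorm (u + v) <= enorm u + enorm v.
Proof.
rewrite -(@ler_pXn2r _ 2) ?nnegrE ?addr_ge0 ?enorm_ge0 //.
rewrite sqrrD !sqr_enorm dotpDl !dotpDr (dotpC v u).
have := le_trans (ler_norm _) (cauchy_schwarz u v); lra.
Qed.

Lemma ler_enorm_dist x y z : enorm (x - z) <= enorm (x - y) + enorm (y - z).
Proof. by apply: le_trans (ler_enormD _ _); rewrite addrA subrK. Qed.

Lemma enorm_le_normr u : enorm u <= Num.sqrt d%:R * `|u|.
Proof.
rewrite -[`|u|]ger0_norm // -sqrtr_sqr -sqrtrM // ler_wsqrtr //.
rewrite mulr_natl -[X in _ *+ X]card_ord -sumr_const; apply: ler_sum => i _.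
rewrite -[X in X <= _]real_normK ?num_real // ler_pXn2r ?nnegrE //.
rewrite [`|u|]mx_normrE.
exact: (le_bigmax _ (fun ij : 'I_1 * 'I_d => `|u ij.1 ij.2|) (0, i)).
Qed.

Lemma eball_center (a : E) (r : R) : 0 < r -> eball a r a.
Proof. by rewrite /eball /= subrr enorm0. Qed.

Lemma continuous_of_local_lipschitz (f : E -> R) (a : E) (r L : R) : 0 < r ->
  (forall x, eball a r x -> `|f x - f a| <= L * enorm (x - a)) ->
  {for a, continuous f}.
Proof.
move=> r0 fL; apply/(@cvgrPdist_le _ _ _ (nbhs a) (nbhs_filter a)) => e e0.
(* The summand 1 keeps [C] positive when [d = 0]. *)
pose C := Num.sqrt d%:R + 1 : R.
have C0 : 0 < C by rewrite ltr_wpDl ?sqrtr_ge0.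
have K0 : 0 < `|L| + 1 by rewrite ltr_wpDl.
have near_a s : 0 < s -> \forall x \near a, `|a - x| < s.
  by move=> s0; apply/nbhs_normP; exists s.
near=> x.
have xa : enorm (x - a) <= C * `|x - a|.
  by rewrite (le_trans (enorm_le_normr _)) // ler_wpM2r // lerDl.
have xr : enorm (x - a) < r.
  rewrite (le_lt_trans xa) // -ltr_pdivlMl // distrC.
  by near: x; apply: near_a; rewrite mulr_gt0 // invr_gt0.
rewrite distrC (le_trans (fL _ xr)) //.
apply: (@le_trans _ _ ((`|L| + 1) * enorm (x - a))).
  by rewrite ler_wpM2r ?enorm_ge0 // (le_trans (ler_norm _)) // lerDl.
rewrite -ler_pdivlMl // (le_trans xa) // -ler_pdivlMl // distrC.
by apply: ltW; near: x; apply: near_a; rewrite !mulr_gt0 // ?invr_gt0.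
Unshelve. all: by end_near. Qed.

Lemma enorm_dist_lip (a x y : E) : `|enorm (x - a) - enorm (y - a)| <= enorm (x - y).
Proof.
have := ler_enorm_dist x y a; have := ler_enorm_dist y x a.
rewrite (enormC y x) ler_norml; lra.
Qed.

Lemma continuous_enorm_dist (a : E) : continuous (fun x => enorm (x - a)).
Proof.
move=> x; apply: (@continuous_of_local_lipschitz _ x 1 1) => // y _.
by rewrite mul1r enorm_dist_lip.
Qed.

Lemma open_eball (a : E) (r : R) : open (eball a r).
Proof.
have -> : eball a r = (fun x => enorm (x - a)) @^-1` [set t | t < r] by [].
by apply: open_comp; [move=> x _; exact: continuous_enorm_dist|exact: open_lt].
Qed.

Lemma compact_closed_eball (a : E) (r : R) : compact [set x | enorm (x - a) <= r].
Proof.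
apply: bounded_closed_compact.
  exists (r + enorm a); split; first exact: num_real.
  move=> M rM x /= xa; rewrite (le_trans (normr_le_enorm x)) // (le_trans _ (ltW rM)) //.
  by have := ler_enorm_dist x a 0; rewrite !subr0; lra.
have -> : [set x | enorm (x - a) <= r] = (fun x => enorm (x - a)) @^-1` [set t | t <= r] by [].
apply: closed_comp; first by move=> x _; exact: continuous_enorm_dist.
exact: closed_le.
Qed.

Lemma open_eball_sub (U : set E) (a : E) : open U -> U a ->
  exists2 r : R, 0 < r & eball a r `<=` U.
Proof.
move=> oU Ua; have /nbhs_ballP [r /= r0 rU] := open_nbhs_nbhs (conj oU Ua).
exists r => // x xa; apply: rU; rewrite -ball_normE /ball_ /= distrC.
exact: le_lt_trans (normr_le_enorm _) xa.
Qed.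

Lemma cvg_of_enorm (xs : nat -> E) (a : E) :
  (forall n, enorm (xs n - a) <= n.+1%:R^-1) -> xs @ \oo --> a.
Proof.
move=> H; apply/cvgrPdist_le => e e0; near=> n.
rewrite distrC (le_trans (normr_le_enorm _)) // (le_trans (H n)) //.
near: n; have := near_infty_natSinv_lt (PosNum e0) => /=.
by apply: filterS => n /ltW.
Unshelve. all: by end_near. Qed.

End Euclid.

(** Stated over any [lmodType] to cover both sets of row vectors and intervals of reals; infima are
    taken over both below. *)
Definition segment_closed (R : realType) (V : lmodType R) (S : set V) : Prop :=
  forall x y, S x -> S y -> forall t : R, 0 <= t <= 1 ->
    S (t *: x + (1 - t) *: y).

(** * Convex functions: Lipschitz bounds, partial minimisation, extension *)

Section Convex.
Variables (R : realType) (d : nat).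
Notation E := 'rV[R]_d.
Implicit Types (x z u v w : E) (D : set E) (g h : E -> R).

Lemma segment_closed_eball (a : E) (r : R) : segment_closed (eball a r).
Proof.
move=> x y xr yr t /andP[t0 t1]; rewrite /eball /=.
have -> : t *: x + (1 - t) *: y - a = t *: (x - a) + (1 - t) *: (y - a).
  by apply/rowP => i; rewrite !mxE; ring.
apply: le_lt_trans (ler_enormD _ _) _.
rewrite !enormZ !ger0_norm ?subr_ge0 //.
move: xr yr; rewrite /eball /=; move: (enorm (x - a)) (enorm (y - a)) => p q pr qr.
apply: (@le_lt_trans _ _ (Num.max p q)); last by rewrite gt_max pr qr.
have pm : p <= Num.max p q by rewrite le_max lexx.
have qm : q <= Num.max p q by rewrite le_max lexx orbT.
by move: (Num.max p q) pm qm => m pm qm; nra.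
Qed.

Lemma convex_onD D g h : convex_on D g -> convex_on D h -> convex_on D (g \+ h).
Proof.
move=> cg ch x y Dx Dy t t01 /=.
by have := cg x y Dx Dy t t01; have := ch x y Dx Dy t t01; lra.
Qed.

Lemma convex_onZ D g (c : R) : 0 <= c -> convex_on D g -> convex_on D (fun x => c * g x).
Proof.
move=> c0 cg x y Dx Dy t t01 /=.
by have := ler_wpM2l c0 (cg x y Dx Dy t t01); lra.
Qed.

Lemma convex_on_sum D (I : Type) (s : seq I) (P : pred I) (F : I -> E -> R) :
  (forall i, P i -> convex_on D (F i)) ->
  convex_on D (fun x => \sum_(i <- s | P i) F i x).
Proof.
move=> cF; elim: s => [|i s IH].
  by move=> x y _ _ t t01; rewrite !big_nil !mulr0 addr0.
case Pi: (P i); last first.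
  by under [X in convex_on _ X]eq_fun => x do rewrite big_cons Pi.
under [X in convex_on _ X]eq_fun => x do rewrite big_cons Pi.
by apply: convex_onD => //; exact: cF.
Qed.

Lemma convex_on_max D g h : convex_on D g -> convex_on D h ->
  convex_on D (fun x => Num.max (g x) (h x)).
Proof.
move=> cg ch x y Dx Dy t /andP[t0 t1]; have t01 : 0 <= t <= 1 by rewrite t0.
have s0 : 0 <= 1 - t by rewrite subr_ge0.
rewrite ge_max; apply/andP; split.
  apply: le_trans (cg x y Dx Dy t t01) _.
  by rewrite lerD // ler_wpM2l // le_max lexx.
apply: le_trans (ch x y Dx Dy t t01) _.
by rewrite lerD // ler_wpM2l // le_max lexx orbT.
Qed.

(* Induction on the list of active coordinates: a point with [i]-th offset in
   [-1, 1] lies between the two points with offsets [-1] and [1]. *)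
Lemma convex_bounded_above_box g : convex_on setT g ->
  forall (s : seq 'I_d) (a : E), exists M : R, forall c : 'I_d -> R,
    (forall i, `|c i| <= 1) ->
    g (a + \sum_(i <- s) c i *: delta_mx 0 i) <= M.
Proof.
move=> cg; elim=> [|i s IH] a.
  by exists (g a) => c _; rewrite big_nil addr0.
have [M1 H1] := IH (a + delta_mx 0 i); have [M2 H2] := IH (a - delta_mx 0 i).
exists (Num.max M1 M2) => c c1; rewrite big_cons.
have := c1 i; rewrite ler_norml => /andP[c0 c2].
set t := (1 + c i) / 2.
have t01 : 0 <= t <= 1 by rewrite /t; apply/andP; split; lra.
set q := \sum_(j <- s) _.
have -> : a + (c i *: delta_mx 0 i + q) =
   t *: (a + delta_mx 0 i + q) + (1 - t) *: (a - delta_mx 0 i + q).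
  by apply/rowP => j; rewrite /t !mxE; field.
apply: le_trans (cg _ _ I I t t01) _.
have m1 : M1 <= Num.max M1 M2 by rewrite le_max lexx.
have m2 : M2 <= Num.max M1 M2 by rewrite le_max lexx orbT.
have := H1 c c1; have := H2 c c1; rewrite -/q.
move: t01 => /andP[]; nra.
Qed.

(** The box estimate bounds [g] above; reflection in [a] bounds it below, since [g a] is at most the
    mean of [g x] and [g (2 *: a - x)]. *)
Lemma convex_bounded g (a : E) : convex_on setT g ->
  exists2 M : R, 0 <= M & forall x, enorm (x - a) <= 1 -> `|g x| <= M.
Proof.
move=> cg; have [M HM] := convex_bounded_above_box cg (index_enum 'I_d) a.
have gM x : enorm (x - a) <= 1 -> g x <= M.
  move=> xa; have -> : x = a + \sum_(i < d) (x - a) 0 i *: delta_mx 0 i.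
    by rewrite -row_sum_delta addrC subrK.
  apply: HM => i; exact: le_trans (coord_le_enorm _ _) xa.
exists (`|M| + 2 * `|g a|); first by rewrite addr_ge0 // mulr_ge0.
move=> x xa; have t01 : 0 <= (2^-1 : R) <= 1 by apply/andP; split; lra.
have := cg x (2 *: a - x) I I _ t01.
have -> : 2^-1 *: x + (1 - 2^-1) *: (2 *: a - x) = a.
  by apply/rowP => i; rewrite !mxE; field.
have xa' : enorm (2 *: a - x - a) <= 1.
  have -> : 2 *: a - x - a = a - x by apply/rowP => i; rewrite !mxE; ring.
  by rewrite enormC.
have := gM _ xa; have := gM _ xa'.
have := ler_norm M; have := ler_norm (- g a); rewrite normrN.
have := normr_ge0 M; have := normr_ge0 (g a); rewrite ler_norml.
by move=> *; apply/andP; split; lra.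
Qed.

Lemma convex_locally_lipschitz g (a : E) : convex_on setT g ->
  exists2 L : R, 0 <= L & forall x y, eball a 2^-1 x -> eball a 2^-1 y ->
    `|g x - g y| <= L * enorm (x - y).
Proof.
move=> cg; have [M M0 HM] := convex_bounded a cg.
have onesided x y : eball a 2^-1 x -> eball a 2^-1 y ->
    g y - g x <= (4 * M) * enorm (x - y).
  rewrite /eball /= => xa ya.
  have [e0|e0] := eqVneq (enorm (x - y)) 0.
    by rewrite e0 -(subrK y x) (enorm_eq0 e0) add0r subrr mulr0.
  have e_gt0 : 0 < enorm (x - y) by rewrite lt_neqAle eq_sym e0 enorm_ge0.
  set e := enorm (x - y) in e0 e_gt0 *.
  (* [z] prolongs the segment from [x] to [y] by length 1/2, staying in the unit ball where
     [|g| <= M]; convexity between [x] and [z] then bounds the slope. *)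
  pose z := y + (2^-1 / e) *: (y - x).
  have za : enorm (z - a) <= 1.
    have -> : z - a = (y - a) + (2^-1 / e) *: (y - x).
      by apply/rowP => i; rewrite !mxE; ring.
    apply: le_trans (ler_enormD _ _) _.
    rewrite enormZ (enormC y x) -/e ger0_norm ?divr_ge0 ?enorm_ge0 //.
    by rewrite -mulrA mulVf // mulr1; lra.
  pose l := e / (e + 2^-1).
  have l01 : 0 <= l <= 1.
    have e2 : 0 < e + 2^-1 by lra.
    by rewrite divr_ge0 ?(ltW e_gt0) ?(ltW e2) //= ler_pdivrMr // mul1r; lra.
  have yE : l *: z + (1 - l) *: x = y.
    apply/rowP => i; rewrite /z /l !mxE; field.
    by rewrite e0 andbT; apply: lt0r_neq0; lra.
  have := cg z x I I _ l01; rewrite yE.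
  have xa1 : enorm (x - a) <= 1 by lra.
  have := HM _ za; have := HM _ xa1; rewrite !ler_norml => /andP[a1 a2] /andP[a3 a4].
  have le2 : l <= 2 * e.
    by rewrite /l ler_pdivrMr; [nra|lra].
  move: l01 => /andP[l0 _] cgz.
  apply: (@le_trans _ _ (l * (2 * M))); first by nra.
  by nra.
exists (4 * M); first by rewrite mulr_ge0.
move=> x y xa ya; rewrite ler_norml; apply/andP; split.
  by have := onesided x y xa ya; lra.
by have := onesided y x ya xa; rewrite (enormC y x); lra.
Qed.

Lemma convex_continuous g : convex_on setT g -> continuous g.
Proof.
move=> cg x; have [L _ HL] := convex_locally_lipschitz x cg.
apply: (@continuous_of_local_lipschitz _ _ g x 2^-1 L) => // y yx.
by apply: HL => //; apply: eball_center.
Qed.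

Section PartialMinimization.
Variables (V : lmodType R) (S : set V) (D : set E) (F : E -> V -> R).
Hypotheses (S0 : S !=set0) (lbF : forall w, D w -> exists m, forall y, S y -> m <= F w y).

Lemma partial_has_inf w : D w -> has_inf [set F w y | y in S].
Proof.
move=> Dw; have [y Sy] := S0; have [m Hm] := lbF Dw.
by split; [exists (F w y), y|exists m => _ [z Sz <-]; exact: Hm].
Qed.

Lemma partial_inf_le w y : D w -> S y -> inf [set F w y | y in S] <= F w y.
Proof.
by move=> Dw Sy; have [_ lb] := partial_has_inf Dw; apply: ge_inf => //; exists y.
Qed.

Lemma le_partial_inf w (m : R) : (forall y, S y -> m <= F w y) ->
  m <= inf [set F w y | y in S].
Proof.
move=> Hm; have [y Sy] := S0; apply: lb_le_inf; first by exists (F w y), y.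
by move=> _ [z Sz <-]; exact: Hm.
Qed.

(** Infima need not be attained: near-minimisers at [w] and [w'] are combined, and joint convexity
    of [F] bounds the value at the combination. *)
Lemma convex_on_partial_inf : segment_closed S -> segment_closed D ->
  (forall w w' y y' (t : R), D w -> D w' -> S y -> S y' -> 0 <= t <= 1 ->
     F (t *: w + (1 - t) *: w') (t *: y + (1 - t) *: y') <=
     t * F w y + (1 - t) * F w' y') ->
  convex_on D (fun w => inf [set F w y | y in S]).
Proof.
move=> cS cD cF w w' Dw Dw' t t01; apply/ler_addgt0Pr => e e0.
have [_ [y Sy <-] ye] := inf_adherent e0 (partial_has_inf Dw).
have [_ [y' Sy' <-] ye'] := inf_adherent e0 (partial_has_inf Dw').
apply: le_trans (partial_inf_le (cD _ _ Dw Dw' t t01) (cS _ _ Sy Sy' t t01)) _.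
apply: le_trans (cF _ _ _ _ _ Dw Dw' Sy Sy' t01) _.
move: t01 => /andP[t0 t1]; nra.
Qed.

Lemma lipschitz_on_partial_inf (L : R) :
  (forall w w' y, D w -> D w' -> S y -> F w y - F w' y <= L * enorm (w - w')) ->
  forall w w', D w -> D w' ->
  `|inf [set F w y | y in S] - inf [set F w' y | y in S]| <= L * enorm (w - w').
Proof.
move=> lF w w' Dw Dw'.
have le1 u u' : D u -> D u' -> inf [set F u y | y in S] - L * enorm (u - u') <=
    inf [set F u' y | y in S].
  move=> Du Du'; apply: le_partial_inf => y Sy.
  by have := partial_inf_le Du Sy; have := lF u u' y Du Du' Sy; lra.
rewrite ler_norml; apply/andP; split.
  by have := le1 w' w Dw' Dw; rewrite (enormC w' w); lra.
by have := le1 w w' Dw Dw'; lra.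
Qed.

End PartialMinimization.

(* Infimal convolution with [L * enorm]. *)
Lemma convex_extension D g (L : R) : segment_closed D -> convex_on D g -> 0 <= L ->
  (forall x y, D x -> D y -> `|g x - g y| <= L * enorm (x - y)) ->
  exists2 h, convex_on setT h & forall x, D x -> h x = g x.
Proof.
move=> cD cg L0 lg.
have [[a Da]|D0] := pselect (D !=set0); last first.
  exists (fun=> 0); first by move=> x y _ _ t _; rewrite !mulr0 addr0.
  by move=> x Dx; case: D0; exists x.
have lb w : setT w -> exists m, forall y, D y -> m <= g y + L * enorm (w - y).
  move=> _; exists (g a - L * enorm (w - a)) => y Dy.
  have := lg y a Dy Da; rewrite ler_norml => /andP[+ _].
  have := ler_wpM2l L0 (ler_enorm_dist y w a); rewrite (enormC y w); lra.
exists (fun w => inf [set g y + L * enorm (w - y) | y in D]).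
  apply: (@convex_on_partial_inf _ D setT (fun w y => g y + L * enorm (w - y))) => //.
    by exists a.
  move=> w w' y y' t _ _ Dy Dy' t01; have := cg y y' Dy Dy' t t01.
  have -> : t *: w + (1 - t) *: w' - (t *: y + (1 - t) *: y') =
            t *: (w - y) + (1 - t) *: (w' - y').
    by apply/rowP => i; rewrite !mxE; ring.
  move: t01 => /andP[t0 t1].
  have := ler_wpM2l L0 (ler_enormD (t *: (w - y)) ((1 - t) *: (w' - y'))).
  by rewrite !enormZ !ger0_norm ?subr_ge0 //; lra.
move=> x Dx; apply/le_anti/andP; split.
  apply: le_trans (partial_inf_le (ex_intro _ a Da) lb I Dx) _.
  by rewrite subrr enorm0 mulr0 addr0.
apply: (@le_partial_inf _ D (fun w y => g y + L * enorm (w - y))) => [|y Dy]; first by exists a.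
by have := lg x y Dx Dy; rewrite ler_norml => /andP[_]; lra.
Qed.

End Convex.

(** * Functions of one real variable: continuity on an interval, supporting lines *)

Lemma within_continuous_lipschitz (R : realType) (q : R -> R) (a b C : R) :
  (forall s t, s \in `[a, b] -> t \in `[a, b] -> `|q s - q t| <= C * `|s - t|) ->
  {within `[a, b], continuous q}.
Proof.
move=> lq; apply/subspace_continuousP => x xab; apply/cvgrPdist_le => e e0.
have C0 : 0 < `|C| + 1 by rewrite ltr_wpDl.
rewrite /within /=; apply/nbhs_normP; exists (e / (`|C| + 1)) => /=.
  by rewrite divr_gt0.
move=> t /=; rewrite ltr_pdivlMr // => xt tab.
apply: le_trans (lq _ _ xab tab) _; apply: le_trans (ltW xt).
by rewrite mulrC ler_wpM2l // (le_trans (ler_norm _)) // lerDl.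
Qed.

Lemma convex_subgradient (R : realType) (H : R -> R) :
  (forall x y t, 0 <= t <= 1 -> H (t * x + (1 - t) * y) <= t * H x + (1 - t) * H y) ->
  forall x, exists s, forall y, H x + s * (y - x) <= H y.
Proof.
move=> cH x.
have slopes t y : t < x -> x < y -> (H x - H t) / (x - t) <= (H y - H x) / (y - x).
  move=> tx xy; have yt : 0 < y - t by lra.
  rewrite ler_pdivrMr ?subr_gt0 // mulrAC ler_pdivlMr ?subr_gt0 //.
  have l01 : 0 <= (y - x) / (y - t) <= 1.
    apply/andP; split; first by apply: divr_ge0; lra.
    by rewrite ler_pdivrMr // mul1r; lra.
  have := cH t y _ l01.
  have -> : (y - x) / (y - t) * t + (1 - (y - x) / (y - t)) * y = x.
    by field; apply: lt0r_neq0.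
  rewrite -(ler_pM2l yt).
  have -> : (y - t) * ((y - x) / (y - t) * H t + (1 - (y - x) / (y - t)) * H y) =
    (y - x) * H t + (x - t) * H y by field; apply: lt0r_neq0.
  lra.
(* Left secant slopes at [x]. Each right secant slope bounds them above, so their supremum, the left
   derivative, is the slope of a supporting line. *)
pose A := [set (H x - H t) / (x - t) | t in [set t | t < x]].
have A0 : A !=set0 by exists ((H x - H (x - 1)) / (x - (x - 1))), (x - 1) => //=; lra.
have ubA y : x < y -> ubound A ((H y - H x) / (y - x)).
  by move=> xy _ [t /= tx <-]; apply: slopes.
exists (sup A) => y; have [yx|xy|->] := ltgtP y x; last by rewrite subrr mulr0 addr0.
- have : (H x - H y) / (x - y) <= sup A.
    apply: ub_le_sup; last by exists y.
    by exists ((H (x + 1) - H x) / (x + 1 - x)); apply: ubA; lra.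
  by rewrite ler_pdivrMr ?subr_gt0 //; lra.
- have := ge_sup A0 (ubA y xy).
  by rewrite ler_pdivlMr ?subr_gt0 //; lra.
Qed.

(** * Convexity from local supports; selections from differences of convex functions *)

Section Selection.
Variables (R : realType) (d : nat).
Notation E := 'rV[R]_d.
Implicit Types (x z u v w : E) (D : set E).

(* Along a segment, the excess of [psi] over its chord, perturbed by a small
   strictly convex term vanishing at both ends, would have an interior maximum;
   a convex support there is incompatible with strict convexity. *)
Lemma convex_on_local_support D (psi : E -> R) (L : R) : segment_closed D ->
  (forall x y, D x -> D y -> `|psi x - psi y| <= L * enorm (x - y)) ->
  (forall w, D w -> exists (r : R) (chi : E -> R),
    [/\ 0 < r, convex_on D chi, chi w = psi w &
        forall w', D w' -> eball w r w' -> chi w' <= psi w']) ->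
  convex_on D psi.
Proof.
move=> cD lpsi supp x y Dx Dy t t01; rewrite leNgt; apply/negP => gap_gt0.
pose z (s : R) := s *: x + (1 - s) *: y.
have Dz s : s \in `[0, 1] -> D (z s) by rewrite in_itv /=; exact: cD.
have zB s s' : enorm (z s - z s') = `|s - s'| * enorm (x - y).
  by rewrite -enormZ; congr enorm; apply/rowP => i; rewrite !mxE; ring.
set gap := psi (z t) - (t * psi x + (1 - t) * psi y).
have {}gap_gt0 : 0 < gap by rewrite subr_gt0.
(* The added term vanishes at 0 and 1 and is at least [- gap / 4], so [q t] is at least
   [3 / 4 * gap]. *)
pose q (s : R) := psi (z s) - (s * psi x + (1 - s) * psi y) + gap * (s ^+ 2 - s).
have contq : {within `[0, 1], continuous q}.
  pose C := `|L| * enorm (x - y) + `|psi x - psi y| + 2 * gap.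
  apply: (@within_continuous_lipschitz _ q 0 1 C) => s s' s01 s'01.
  have -> : q s - q s' = (psi (z s) - psi (z s')) - (s - s') * (psi x - psi y) +
      gap * ((s - s') * (s + s' - 1)) by rewrite /q; ring.
  have -> : C * `|s - s'| = `|L| * enorm (x - y) * `|s - s'| +
      `|psi x - psi y| * `|s - s'| + 2 * gap * `|s - s'| by rewrite /C !mulrDl.
  apply: le_trans (ler_normD _ _) _; apply: lerD.
    apply: le_trans (ler_normB _ _) _; apply: lerD; last by rewrite normrM mulrC.
    apply: le_trans (lpsi _ _ (Dz _ s01) (Dz _ s'01)) _.
    by rewrite zB (mulrC `|s - s'|) mulrA ler_wpM2r // ler_wpM2r ?enorm_ge0 // ler_norm.
  rewrite normrM (gtr0_norm gap_gt0) normrM (mulrC 2) -mulrA ler_wpM2l ?(ltW gap_gt0) //.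
  rewrite mulrC ler_wpM2r // ler_norml.
  by move: s01 s'01; rewrite !in_itv /= => /andP[? ?] /andP[? ?]; apply/andP; split; lra.
have [c c01 cmax] := EVT_max ler01 contq.
have t01' : t \in `[0, 1] by rewrite in_itv.
have qt : 0 < q t.
  have -> : q t = 3 / 4 * gap + gap * (t - 2^-1) ^+ 2 by rewrite /q -/gap; field.
  by have := mulr_ge0 (ltW gap_gt0) (sqr_ge0 (t - 2^-1)); lra.
have qc := lt_le_trans qt (cmax t t01').
have q0 : q 0 = 0.
  rewrite /q /z scale0r add0r subr0 scale1r; ring.
have q1 : q 1 = 0.
  rewrite /q /z subrr scale0r addr0 scale1r; ring.
have [c0 c1] : 0 < c /\ c < 1.
  move: (c01); rewrite in_itv /= => /andP[c0 c1].
  rewrite !lt_neqAle c0 c1 !andbT; split; apply/negP => /eqP e.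
    by move: qc; rewrite -e q0 ltxx.
  by move: qc; rewrite e q1 ltxx.
have [r [chi [r0 cchi chic chile]]] := supp _ (Dz _ c01).
pose n := enorm (x - y) + 1.
have n0 : 0 < n by rewrite ltr_wpDl ?enorm_ge0.
(* This [e] keeps [c - e] and [c + e] in [[0, 1]], and their points on the segment in the ball where
   [chi] lies below [psi]. *)
pose e := Num.min (Num.min c (1 - c)) (r / n) / 2.
have m0 : 0 < Num.min (Num.min c (1 - c)) (r / n).
  by rewrite !lt_min c0 subr_gt0 c1 divr_gt0.
have [ec ec1 en] : [/\ e <= c / 2, e <= (1 - c) / 2 & e <= (r / n) / 2].
  by rewrite /e !ler_pM2r ?invr_gt0 // !ge_min !lexx ?orbT.
have e0 : 0 < e by rewrite /e divr_gt0.
have near_le s : `|s - c| = e -> s \in `[0, 1] -> chi (z s) <= psi (z s).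
  move=> se s01; apply: chile; first exact: Dz.
  rewrite /eball /= zB se; apply: (@le_lt_trans _ _ (e * n)).
    by rewrite ler_pM2l // lerDl.
  by rewrite -ltr_pdivlMr // (le_lt_trans en) // ltr_pdivrMr // ltr_pMr ?ltr1n // divr_gt0.
have p01 : c + e \in `[0, 1] by rewrite in_itv /=; apply/andP; split; lra.
have m01 : c - e \in `[0, 1] by rewrite in_itv /=; apply/andP; split; lra.
have Hp := near_le (c + e) _ p01; have Hm := near_le (c - e) _ m01.
have {}Hp : chi (z (c + e)) <= psi (z (c + e)).
  by apply: Hp; rewrite addrC addKr gtr0_norm.
have {}Hm : chi (z (c - e)) <= psi (z (c - e)).
  by apply: Hm; rewrite addrC addKr normrN gtr0_norm.
have h01 : 0 <= (2^-1 : R) <= 1 by apply/andP; split; lra.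
(* Convexity of [chi] at the midpoint makes [q (c + e) + q (c - e)] at least
   [2 * q c + 2 * gap * e ^+ 2], against the maximality of [q c]. *)
have := cchi _ _ (Dz _ p01) (Dz _ m01) _ h01.
have -> : 2^-1 *: z (c + e) + (1 - 2^-1) *: z (c - e) = z c.
  by apply/rowP => i; rewrite /z !mxE; field.
rewrite chic.
have := cmax _ p01; have := cmax _ m01; rewrite /q.
have : 0 < gap * e ^+ 2 by rewrite mulr_gt0 // exprn_gt0.
lra.
Qed.

Lemma lipschitz_add_sum (D : set E) (G : nat -> E -> R) (n : nat) (phi : E -> R) (L : R) :
  (forall j x y, D x -> D y -> `|G j x - G j y| <= L * enorm (x - y)) ->
  (forall x y, D x -> D y -> `|phi x - phi y| <= L * enorm (x - y)) ->
  forall x y, D x -> D y ->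
  `|phi x + \sum_(j < n) G j x - (phi y + \sum_(j < n) G j y)| <=
    (L + L *+ n) * enorm (x - y).
Proof.
move=> lG lphi x y Dx Dy.
have -> : phi x + \sum_(j < n) G j x - (phi y + \sum_(j < n) G j y) =
    (phi x - phi y) + \sum_(j < n) (G j x - G j y) by rewrite sumrB; ring.
apply: le_trans (ler_normD _ _) _; rewrite mulrDl lerD ?lphi //.
apply: le_trans (ler_norm_sum _ _ _) _.
rewrite -[X in _ *+ X]card_ord -sumr_const mulr_suml.
by apply: ler_sum => j _; exact: lG.
Qed.

(* With [m] the least index such that [G m - G m.+1] is at least [phi] at a
   point, [phi >= G m - G m.+1] near this point by continuity; adding all the
   [G j] makes this lower bound convex. *)
Lemma convex_on_ordered_selection D (G : nat -> E -> R) (n : nat) (phi : E -> R) (L : R) :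
  segment_closed D -> 0 <= L ->
  (forall j, convex_on D (G j)) ->
  (forall j x y, D x -> D y -> `|G j x - G j y| <= L * enorm (x - y)) ->
  (forall x y, D x -> D y -> `|phi x - phi y| <= L * enorm (x - y)) ->
  (forall j x, D x -> G j x + G j.+2 x <= 2 * G j.+1 x) ->
  (forall x, D x -> exists2 j, (j <= n)%N & phi x = G j x - G j.+1 x) ->
  convex_on D (fun x => phi x + \sum_(j < n.+2) G j x).
Proof.
move=> cD L0 cG lG lphi concG sel.
have slope_le x i j : D x -> (i <= j)%N -> G i x - G i.+1 x <= G j x - G j.+1 x.
  move=> Dx; elim: j => [|j IH]; first by rewrite leqn0 => /eqP ->.
  rewrite leq_eqVlt => /predU1P[-> //|/IH]; have := concG j x Dx; lra.
apply: (@convex_on_local_support _ _ (L + L *+ n.+2)) => // [|w Dw].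
  exact: lipschitz_add_sum.
have [k kn phik] := sel w Dw.
have exm : exists j, phi w <= G j w - G j.+1 w by exists k; rewrite phik.
pose m := ex_minn exm.
have [m_ge m_min] : phi w <= G m w - G m.+1 w /\
    (forall j, phi w <= G j w - G j.+1 w -> (m <= j)%N).
  by rewrite /m; case: ex_minnP.
have mk : (m <= k)%N by apply: m_min; rewrite phik.
have phim : phi w = G m w - G m.+1 w.
  by apply/le_anti; rewrite m_ge phik slope_le.
have m1n : (m.+1 < n.+2)%N by rewrite !ltnS (leq_trans mk).
have mn : (m < n.+2)%N := ltnW m1n.
have [r r0 Hr] : exists2 r : R, 0 < r & forall w', D w' -> eball w r w' ->
    G m w' - G m.+1 w' <= phi w'.
  case: (posnP m) => [m0|m_gt0].
    by exists 1 => // w' Dw' _; have [j _ ->] := sel w' Dw'; rewrite m0 slope_le.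
  have pm : phi w > G m.-1 w - G m w.
    rewrite ltNge; apply/negP => H.
    by have := m_min m.-1; rewrite prednK // => /(_ H); rewrite leqNgt prednK // leqnn.
  set gap := phi w - (G m.-1 w - G m w).
  have gap_gt0 : 0 < gap by rewrite subr_gt0.
  (* [phi], [G m.-1] and [G m] each vary by at most [L * enorm (w' - w)], so [phi] still exceeds
     [G m.-1 - G m] on this ball and any index selected there is at least [m]. The 1 covers
     [L = 0]. *)
  exists (gap / (3 * L + 1)); first by rewrite divr_gt0 // ltr_wpDl // mulr_ge0.
  move=> w' Dw'; rewrite /eball /= ltr_pdivlMr; last by rewrite ltr_wpDl // mulr_ge0.
  move=> w'w; have [j _ phij] := sel w' Dw'; rewrite phij; apply: (slope_le w') => //.
  rewrite leqNgt; apply/negP => jm.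
  have := slope_le w' j m.-1 Dw'; rewrite -ltnS prednK // => /(_ jm).
  have := lG m.-1 w' w Dw' Dw; have := lG m w' w Dw' Dw; have := lphi w' w Dw' Dw.
  have := enorm_ge0 (w' - w).
  rewrite !ler_norml -phij /gap in w'w *.
  by move=> ? /andP[? ?] /andP[? ?] /andP[? ?]; lra.
exists r, (fun x => (G m x - G m.+1 x) + \sum_(j < n.+2) G j x); split=> //.
(* The summands of index [m] and [m.+1] turn [G m - G m.+1] into [2 * G m]; as [m <= n], the sum has
   to reach index [n.+1]. *)
- have -> : (fun x => (G m x - G m.+1 x) + \sum_(j < n.+2) G j x) =
    (fun x => 2 * G m x) \+ (fun x => \sum_(j < n.+2 |
       (j != Ordinal mn) && (j != Ordinal m1n)) G j x).
    apply/funext => x /=; rewrite (bigD1 (Ordinal mn)) //= (bigD1 (Ordinal m1n)) /=.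
      by ring.
    by rewrite -val_eqE /= gtn_eqF.
  apply: convex_onD; first by apply: convex_onZ.
  by apply: convex_on_sum => j _; exact: cG.
- by rewrite phim.
- by move=> w' Dw' w'r; rewrite lerD2r Hr.
Qed.

End Selection.

(** * Orthogonal splitting along a unit vector; subgraphs of DC functions *)

Section Projection.
Variables (R : realType) (d : nat).
Notation E := 'rV[R]_d.
Implicit Types (x y w a : E).
Variable v : E.
Hypothesis v1 : enorm v = 1.

Definition hproj x : E := x - dotp x v *: v.

Lemma dotvv : dotp v v = 1.
Proof. by rewrite -sqr_enorm v1 expr1n. Qed.

Lemma dotp_hproj x : dotp (hproj x) v = 0.
Proof. by rewrite /hproj dotpBl dotpZl dotvv mulr1 subrr. Qed.

Lemma hprojK x : hproj x + dotp x v *: v = x.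
Proof. by rewrite /hproj subrK. Qed.

Lemma dotp_graph w (t : R) : dotp w v = 0 -> dotp (w + t *: v) v = t.
Proof. by move=> w0; rewrite dotpDl dotpZl dotvv w0 add0r mulr1. Qed.

Lemma hproj_graph w (t : R) : dotp w v = 0 -> hproj (w + t *: v) = w.
Proof. by move=> w0; rewrite /hproj dotp_graph // addrK. Qed.

Lemma hprojB x y : hproj x - hproj y = hproj (x - y).
Proof. by apply/rowP => i; rewrite /hproj dotpBl !mxE; ring. Qed.

Lemma hproj_comb (t : R) x y :
  hproj (t *: x + (1 - t) *: y) = t *: hproj x + (1 - t) *: hproj y.
Proof. by apply/rowP => i; rewrite /hproj dotpDl !dotpZl !mxE; ring. Qed.

Lemma hprojDv x (t : R) : hproj (x + t *: v) = hproj x.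
Proof.
by apply/rowP => i; rewrite /hproj dotpDl dotpZl dotvv !mxE; ring.
Qed.

Lemma enorm_hproj x : enorm (hproj x) <= enorm x.
Proof.
rewrite -(@ler_pXn2r _ 2) ?nnegrE ?enorm_ge0 // !sqr_enorm {2}/hproj dotpBr.
rewrite dotpZr dotp_hproj mulr0 subr0 /hproj dotpBl dotpZl (dotpC v x) lerBlDr lerDl.
by rewrite -expr2 sqr_ge0.
Qed.

Lemma dotp_le_enorm x : `|dotp x v| <= enorm x.
Proof. by have := cauchy_schwarz x v; rewrite v1 mulr1. Qed.

Variable W : 'M[R]_d.
Hypotheses (rkW : \rank W = d.-1) (Wv : forall w : E, (w <= W)%MS -> dotp w v = 0).

(* By the rank hypothesis, [W] is the whole orthogonal of [v]. *)
Lemma mem_hyperplane w : (w <= W)%MS <-> dotp w v = 0.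
Proof.
split; first exact: Wv.
have dotE u : dotp u v = (u *m v^T) 0 0.
  by rewrite mxE; apply: eq_bigr => i _; rewrite !mxE.
have WK : (W <= kermx v^T)%MS.
  apply/sub_kermxP/row_matrixP => i; rewrite row_mul row0.
  by apply/matrixP => j k; rewrite !ord1 -dotE mxE; apply: Wv; exact: row_sub.
have v_neq0 : v != 0.
  by apply/eqP => v0; move: v1; rewrite v0 enorm0 => /eqP; rewrite eq_sym oner_eq0.
have [_] := mxrank_leqif_sup WK; rewrite mxrank_ker mxrank_tr rank_rV v_neq0 rkW subn1 eqxx.
move=> /esym KW wv; apply: submx_trans KW; apply/sub_kermxP.
by apply/matrixP => i j; rewrite !ord1 -dotE wv mxE.
Qed.

Lemma hproj_mem x : (hproj x <= W)%MS.
Proof. by apply/mem_hyperplane; exact: dotp_hproj. Qed.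

(** The form in which charts are used: the coordinates [hproj x] and [dotp x v] replace the
    existential decomposition. *)
Lemma subgraphE (phi : E -> R) x : subgraph W v phi x <-> dotp x v <= phi (hproj x).
Proof.
split=> [[w [t [wW tphi ->]]]|xphi].
  by rewrite dotp_graph ?hproj_graph //; apply: Wv.
by exists (hproj x), (dotp x v); split; rewrite ?hprojK //; exact: hproj_mem.
Qed.

Lemma subgraph_WDC (phi : E -> R) :
  DC_on [set w : E | (w <= W)%MS] phi -> WDC (subgraph W v phi).
Proof.
move=> [g [h [cg ch phiE]]].
have cP k : convex_on [set w : E | (w <= W)%MS] k -> convex_on setT (k \o hproj).
  by move=> ck x y _ _ t t01 /=; rewrite hproj_comb; apply: ck => //; exact: hproj_mem.
(* With [t = dotp x v], [max(0, t - (g - h)) = max(g, t + h) - g] is a difference of convex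
   functions. *)
pose p x := Num.max (g (hproj x)) (dotp x v + h (hproj x)).
have cp : convex_on setT p.
  apply: convex_on_max; first exact: cP.
  apply: (@convex_onD _ _ setT (fun x => dotp x v) (h \o hproj)); last exact: cP.
  by move=> x y _ _ t t01; rewrite dotpDl !dotpZl.
pose f x := p x - g (hproj x).
have fE x : f x = Num.max 0 (dotp x v - phi (hproj x)).
  rewrite /f /p phiE; last exact: hproj_mem.
  by rewrite -[- g _]opprK opprK addr_maxl subrr; congr Num.max; ring.
have cf : continuous f.
  move=> x; apply: (@continuousB _ _ _ p (g \o hproj)).
    exact: (convex_continuous cp).
  exact: (convex_continuous (cP _ cg)).
exists f; split.
- by exists p, (g \o hproj); split=> //; exact: cP.
- by move=> x; rewrite fE le_max lexx.
- apply/seteqP; split=> x /=; rewrite subgraphE fE; first by move=> H; apply/max_idPl; lra.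
  by move=> /max_idPl; lra.
(* Near a point where [f > 0], short difference quotients in direction [- v] equal -1; hence every
   subgradient [u] there has [dotp u v >= 1]. *)
move=> x0 xs us _ _ fpos clk; exists 1 => //; near=> i.
suff : 1 <= dotp (us i) v by move=> /le_trans; apply; apply: le_trans (dotp_le_enorm _); exact: ler_norm.
apply/ler_addgt0Pr => e e0.
have oU : open [set x | 0 < f x].
  by apply: (@open_comp _ _ f [set t | 0 < t]); [move=> ? _; exact: cf|exact: open_gt].
have [r r0 rU] := open_eball_sub oU (fpos i).
have r2 : 0 < r / 2 by rewrite divr_gt0.
have [y [t [yx t0 tr]]] := clk i (- v) e (r / 2) e0 r2.
have fy : 0 < f y by apply: rU; rewrite /eball /=; lra.
have fy' : 0 < f (y + t *: - v).
  apply: rU; rewrite /eball /=.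
  have -> : y + t *: - v - xs i = (y - xs i) + (- t) *: v.
    by apply/rowP => j; rewrite !mxE; ring.
  by have := ler_enormD (y - xs i) ((- t) *: v); rewrite enormZ v1 normrN gtr0_norm //; lra.
have posE x : 0 < f x -> f x = dotp x v - phi (hproj x).
  by rewrite fE lt_max ltxx /= => H; apply/max_idPr/ltW.
rewrite (posE _ fy) (posE _ fy') scalerN -scaleNr hprojDv dotpDl dotpZl dotvv dotpNr.
have -> : (dotp y v + - t * 1 - phi (hproj y) - (dotp y v - phi (hproj y))) / t = -1.
  by field; apply: lt0r_neq0.
lra.
Unshelve. all: by end_near. Qed.

End Projection.

(** * Clarke subgradients and the error bound from weak regularity *)

Section Clarke.
Variables (R : realType) (d : nat).
Notation E := 'rV[R]_d.
Implicit Types (x y z u w a : E) (f : E -> R).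

(** Proximal subgradients are Clarke subgradients: the quotient based at [z] itself is at least
    [dotp u v - K * t * enorm v ^+ 2], and small [t] absorbs the error. *)
Lemma clarke_proximal f z u (r K : R) : 0 < r -> 0 <= K ->
  (forall y, enorm (y - z) < r -> f z + dotp u (y - z) - K * enorm (y - z) ^+ 2 <= f y) ->
  clarke_subgrad f z u.
Proof.
move=> r0 K0 H v eps delta eps0 delta0.
have v0 := enorm_ge0 v.
pose k := K * enorm v ^+ 2.
have k0 : 0 <= k by rewrite mulr_ge0 // sqr_ge0.
(* The three bounds give [t < delta], keep [z + t *: v] in the ball of radius [r], and make the
   error [t * k] less than [eps]. *)
pose t := Num.min (delta / 2) (Num.min (r / (enorm v + 1)) (eps / (k + 1))) / 2.
have m0 : 0 < Num.min (delta / 2) (Num.min (r / (enorm v + 1)) (eps / (k + 1))).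
  by rewrite !lt_min !divr_gt0 // ltr_wpDl.
have t0 : 0 < t by rewrite /t divr_gt0.
have [t1 t2 t3] : [/\ t < delta / 2, t < r / (enorm v + 1) & t < eps / (k + 1)].
  have tm : t < Num.min (delta / 2) (Num.min (r / (enorm v + 1)) (eps / (k + 1))).
    by rewrite /t ltr_pdivrMr // ltr_pMr // ltr1n.
  by split; apply: (lt_le_trans tm); rewrite !ge_min lexx ?orbT.
rewrite ltr_pdivlMr in t2; last by rewrite ltr_wpDl.
rewrite ltr_pdivlMr in t3; last by rewrite ltr_wpDl.
exists z, t; split=> //; first by rewrite subrr enorm0.
  by lra.
have := H (z + t *: v); rewrite addrC addKr enormZ gtr0_norm // dotpZr => /(_ _) H'.
have {}H' := H' ltac:(lra).
rewrite ltr_pdivlMr //.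
have := ltr_pM2l t0 (t * (k + 1)) eps; rewrite t3 => /idP.
have : 0 < t * t by rewrite mulr_gt0.
move: H'; rewrite -/k exprMn mulrCA -/k (addrC z) expr2; lra.
Qed.

(** From sequences to a neighbourhood: if every [1 / (n + 1)] failed as both bound and radius,
    choice would give points tending to [a] with subgradients tending to 0. *)
Lemma weakly_regular_uniform f a : weakly_regular_value f 0 -> f a = 0 ->
  exists e r : R, [/\ 0 < e, 0 < r &
    forall x u, enorm (x - a) < r -> 0 < f x -> clarke_subgrad f x u -> e <= enorm u].
Proof.
move=> reg fa0; apply: contrapT => H.
have bad (n : nat) : exists xu : E * E, [/\ enorm (xu.1 - a) < n.+1%:R^-1, 0 < f xu.1,
    clarke_subgrad f xu.1 xu.2 & enorm xu.2 < n.+1%:R^-1].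
  apply: contrapT => Hn; apply: H; exists n.+1%:R^-1, n.+1%:R^-1; split=> //.
  move=> x u xa fx cu; rewrite leNgt; apply/negP => un.
  by apply: Hn; exists (x, u).
have [xu Hxu] := choice bad.
have [] := reg a (fun n => (xu n).1) (fun n => (xu n).2) _ fa0.
- by apply: cvg_of_enorm => n; have [/ltW] := Hxu n.
- by move=> n; have [] := Hxu n.
- by move=> n; have [] := Hxu n.
move=> e e0 He; near \oo => n.
have [_ _ _] := Hxu n; apply/negP; rewrite -leNgt.
apply: (@le_trans _ _ e); last by near: n.
near: n; have := near_infty_natSinv_lt (PosNum e0) => /=.
by apply: filterS => n /ltW.
Unshelve. all: by end_near. Qed.

(* Minimise [f y + k |y - x|^2] over the ball, with [k = e / (2 D)]: if [f x]
   were smaller than [e D / 2], a minimiser [z] would lie in the open ball and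
   [- 2 k (z - x)] would be a Clarke subgradient at [z] shorter than [e]. *)
Lemma error_bound f a (e r : R) : continuous f -> (forall x, 0 <= f x) -> 0 < e ->
  (forall x u, enorm (x - a) < r -> 0 < f x -> clarke_subgrad f x u -> e <= enorm u) ->
  forall x (D : R), 0 < D -> enorm (x - a) + D < r ->
  (forall y, enorm (y - x) < D -> 0 < f y) -> e * D / 2 <= f x.
Proof.
move=> cf f0 e0 He x D D0 xr posf; rewrite leNgt; apply/negP => fx.
pose k := e / (2 * D).
have k0 : 0 < k by rewrite divr_gt0 // mulr_gt0.
have kD : k * D ^+ 2 = e * D / 2 by rewrite /k; field; apply: lt0r_neq0.
pose F y := f y + k * enorm (y - x) ^+ 2.
pose B := [set y : E | enorm (y - x) <= D].
have cF : continuous F.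
  have cn := @continuous_enorm_dist _ _ x.
  move=> y; apply: (@continuousD _ _ _ f (fun y => k * enorm (y - x) ^+ 2)); first exact: cf.
  apply: (@continuousM _ _ (cst k) (fun y => enorm (y - x) ^+ 2)); first exact: cst_continuous.
  by apply: (@continuousM _ _ (fun y => enorm (y - x)) (fun y => enorm (y - x))); exact: cn.
have [] := @EVT_min_rV _ _ F B.
- by exists x; rewrite /B /= subrr enorm0 ltW.
- exact: compact_closed_eball.
- by apply: continuous_subspaceT; exact: cF.
move=> z; rewrite inE /B /= => zD zmin.
have xB : x \in B by rewrite inE /B /= subrr enorm0 ltW.
have := zmin _ xB; rewrite /F subrr enorm0 expr0n /= mulr0 addr0 => Fz.
have zx0 := enorm_ge0 (z - x).
have {}zD : enorm (z - x) < D.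
  rewrite -(@ltr_pXn2r _ 2) ?nnegrE ?(ltW D0) // -(ltr_pM2l k0) kD.
  by have := f0 z; lra.
have cz : clarke_subgrad f z ((- 2 * k) *: (z - x)).
  apply: (@clarke_proximal _ _ _ (D - enorm (z - x)) k); rewrite ?subr_gt0 ?ltW //.
  move=> y yz; have yB : y \in B.
    by rewrite inE /B /=; have := ler_enorm_dist y z x; lra.
  have := zmin _ yB; rewrite /F.
  have -> : y - x = (z - x) + (y - z) by apply/rowP => i; rewrite !mxE; ring.
  move: (z - x) (y - z) => p q.
  rewrite !sqr_enorm dotpDl !dotpDr dotpZl (dotpC q p); lra.
have za : enorm (z - a) < r by have := ler_enorm_dist z x a; lra.
have := He _ _ za (posf _ zD) cz; apply/negP; rewrite -ltNge.
have k2 : 0 < 2 * k by apply: mulr_gt0.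
rewrite enormZ mulNr normrN (gtr0_norm k2).
have -> : e = 2 * k * D by rewrite /k; field; apply: lt0r_neq0.
by rewrite ltr_pM2l.
Qed.

End Clarke.

(** * From kinks of a convex function to a DC representation *)

Lemma grid_point (R : realType) (M delta s : R) : 0 < delta -> - M <= s <= M ->
  exists2 j, (j <= (Num.truncn (2 * M / delta)).+1)%N &
    s <= - M + j%:R * delta < s + delta.
Proof.
move=> delta0 /andP[Ms sM].
have Hn : s <= - M + (Num.truncn (2 * M / delta)).+1%:R * delta.
  have := truncnS_gt (2 * M / delta); rewrite ltr_pdivrMr //; lra.
have exj : exists j, s <= - M + j%:R * delta by exists (Num.truncn (2 * M / delta)).+1.
case: (ex_minnP exj) => j Hj jmin; exists j; first exact: jmin.
rewrite Hj /=; case: j => [|j] in Hj jmin *; first by rewrite mul0r; lra.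
rewrite ltNge; apply/negP => H; have := jmin j.
rewrite ltnn => /(_ _); suff: s <= - M + j%:R * delta by move=> /[swap] /[apply].
by move: H; rewrite -natr1; lra.
Qed.

Section Kink.
Variables (R : realType) (d : nat).
Notation E := 'rV[R]_d.
Implicit Types (x y w : E).

(* [G j w] is the minimum over [t] of [(g (w + t v) - s_j t) / delta] for slopes
   [s_j] in arithmetic progression of step [delta = c / 2]. The kink contains two
   consecutive slopes [s_j], [s_{j+1}]; both minima are then attained at [phi w],
   so that [phi w = G j w - G j.+1 w]. *)
Lemma DC_of_kink (v : E) (D : set E) (g phi : E -> R) (t0 eta m M c : R) :
  segment_closed D -> 0 <= M -> 0 < c -> convex_on setT g ->
  (forall w w' t, D w -> D w' -> `|t - t0| <= eta ->
     `|g (w + t *: v) - g (w' + t *: v)| <= M * enorm (w - w')) ->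
  (forall w t, D w -> `|t - t0| <= eta -> m <= g (w + t *: v)) ->
  (forall w w', D w -> D w' -> `|phi w - phi w'| <= M * enorm (w - w')) ->
  (forall w, D w -> `|phi w - t0| <= eta) ->
  (forall w, D w -> exists2 s, - M <= s <= M & forall s', s <= s' <= s + c ->
     forall t, `|t - t0| <= eta ->
       g (w + phi w *: v) - s' * phi w <= g (w + t *: v) - s' * t) ->
  exists p q : E -> R, [/\ convex_on setT p, convex_on setT q &
    forall w, D w -> phi w = p w - q w].
Proof.
move=> cD M0 c0 cg lg lbg lphi phiI kink.
have [[a Da]|D0] := pselect (D !=set0); last first.
  exists (fun=> 0), (fun=> 0); split; try by move=> x y _ _ t _; rewrite !mulr0 addr0.
  by move=> w Dw; case: D0; exists w.
pose I := [set t : R | `|t - t0| <= eta].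
have I0 : I !=set0 by exists (phi a); exact: phiI.
pose delta := c / 2; have delta0 : 0 < delta by rewrite divr_gt0.
pose s_ (j : nat) := - M + j%:R * delta.
(* Division by [delta] gives [F j w t - F j.+1 w t = t]. *)
pose F j (w : E) (t : R) := (g (w + t *: v) - s_ j * t) / delta.
pose G j w := inf [set F j w t | t in I].
have lbF j w : D w -> exists b, forall t, I t -> b <= F j w t.
  move=> Dw; exists ((m - `|s_ j| * (`|t0| + eta)) / delta) => t It.
  rewrite ler_pM2r ?invr_gt0 //; have := lbg w t Dw It.
  have : `|s_ j * t| <= `|s_ j| * (`|t0| + eta).
    rewrite normrM ler_wpM2l // -[t](subrK t0) addrC.
    by apply: le_trans (ler_normD _ _) _; rewrite lerD2l.
  by move=> /(le_trans (ler_norm _)); lra.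
have cI : segment_closed I.
  move=> x y Ix Iy t /andP[t_ge0 t_le1]; rewrite /I /=.
  have -> : t *: x + (1 - t) *: y - t0 = t * (x - t0) + (1 - t) * (y - t0).
    by rewrite /GRing.scale /=; ring.
  apply: le_trans (ler_normD _ _) _; have s_ge0 : 0 <= 1 - t by lra.
  rewrite !normrM (ger0_norm t_ge0) (ger0_norm s_ge0).
  move: Ix Iy; rewrite /I /=; move: `|x - t0| `|y - t0| => p q pe qe; nra.
have cG j : convex_on D (G j).
  apply: (convex_on_partial_inf I0 (lbF j) cI cD) => w w' t t' u _ _ _ _ u01.
  rewrite /F !mulrA -mulrDl ler_pM2r ?invr_gt0 //.
  have := cg (w + t *: v) (w' + t' *: v) Logic.I Logic.I u u01.
  have -> : u *: (w + t *: v) + (1 - u) *: (w' + t' *: v) =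
      u *: w + (1 - u) *: w' + (u * t + (1 - u) * t') *: v.
    by apply/rowP => i; rewrite !mxE; ring.
  by rewrite /GRing.scale /=; lra.
pose L := M / delta + M.
have Md0 : 0 <= M / delta by rewrite divr_ge0 // ltW.
have lG j w w' : D w -> D w' -> `|G j w - G j w'| <= L * enorm (w - w').
  move=> Dw Dw'; apply: (@le_trans _ _ (M / delta * enorm (w - w'))).
    apply: (lipschitz_on_partial_inf I0 (lbF j)) => // x y t Dx Dy It.
    rewrite /F -mulrBl mulrAC ler_pM2r ?invr_gt0 //.
    have := lg x y t Dx Dy It; rewrite ler_norml => /andP[_]; lra.
  by rewrite ler_wpM2r ?enorm_ge0 // lerDl.
have lphi' w w' : D w -> D w' -> `|phi w - phi w'| <= L * enorm (w - w').
  move=> Dw Dw'; apply: le_trans (lphi _ _ Dw Dw') _.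
  by rewrite ler_wpM2r ?enorm_ge0 // lerDr.
have L0 : 0 <= L by rewrite addr_ge0.
(* [F j w t] is affine in [j], so its infimum over [t] is concave in [j]. *)
have concG j w : D w -> G j w + G j.+2 w <= 2 * G j.+1 w.
  move=> Dw; rewrite mulrC -ler_pdivrMr //.
  apply: (le_partial_inf (F := F j.+1) I0) => t It.
  have := partial_inf_le I0 (lbF j) Dw It.
  have := partial_inf_le I0 (lbF j.+2) Dw It; rewrite -!/(G _ w).
  have -> : F j.+1 w t = (F j w t + F j.+2 w t) / 2.
    by rewrite /F /s_ -!natr1; field; apply: lt0r_neq0.
  lra.
pose n := (Num.truncn (2 * M / delta)).+1.
have sel w : D w -> exists2 j, (j <= n)%N & phi w = G j w - G j.+1 w.
  move=> Dw; have [s sM Hs] := kink w Dw.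
  have [j jn /andP[sj js]] := grid_point delta0 sM; exists j => //.
  (* For slopes in [[s, s + c]] the infimum is attained at [phi w]. As [delta] is half of [c], this
     interval contains both [s_ j] and [s_ j.+1]. *)
  have Gphi k : s <= s_ k <= s + c -> G k w = F k w (phi w).
    move=> sk; apply/le_anti/andP; split.
      exact: (partial_inf_le I0 (lbF k) Dw (phiI w Dw)).
    apply: (le_partial_inf (F := F k) I0) => t It.
    by rewrite /F ler_pM2r ?invr_gt0 // Hs.
  have dc : c = delta + delta by rewrite /delta; field.
  rewrite !Gphi; first by rewrite /F /s_ -natr1; field; apply: lt0r_neq0.
    by rewrite /s_ -natr1; apply/andP; split; lra.
  by rewrite /s_; apply/andP; split; lra.
have cpsi := convex_on_ordered_selection cD L0 cG lG lphi' concG sel.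
(* The summand 0 puts the sum in the shape of [lipschitz_add_sum] with [phi] zero. *)
have ckappa : convex_on D (fun w => 0 + \sum_(j < n.+2) G j w).
  apply: (@convex_onD _ _ D (fun=> 0)); last by apply: convex_on_sum => j _; exact: cG.
  by move=> x y _ _ t _; rewrite !mulr0 addr0.
have K0 : 0 <= L + L *+ n.+2 by rewrite addr_ge0 // mulrn_wge0.
have l0 x y : D x -> D y -> `|(0 : R) - 0| <= L * enorm (x - y).
  by move=> _ _; rewrite subrr normr0 mulr_ge0 // enorm_ge0.
have [p cp pE] := convex_extension cD cpsi K0 (lipschitz_add_sum n.+2 lG lphi').
have [q cq qE] := convex_extension cD ckappa K0
  (@lipschitz_add_sum _ _ D G n.+2 (fun=> 0) L lG l0).
exists p, q; split=> // w Dw; rewrite pE // qE //; ring.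
Qed.

End Kink.

(** * Local DC representation of a Lipschitz graph *)

Section Graph.
Variables (R : realType) (d : nat).
Notation E := 'rV[R]_d.
Implicit Types (x y w a : E).

Lemma lipschitz_onP (D : set E) (phi : E -> R) : Defs.lipschitz_on D phi ->
  exists2 L : R, 0 <= L & forall x y, D x -> D y -> `|phi x - phi y| <= L * enorm (x - y).
Proof.
move=> [L HL]; exists `|L| => // x y Dx Dy; apply: le_trans (HL x y Dx Dy) _.
by rewrite ler_wpM2r ?enorm_ge0 // ler_norm.
Qed.

(** Checks the hypotheses of [DC_of_kink] on lines parallel to [v] near a graph point; the lower
    bound [e] on subgradients determines the size of the kink. *)
Lemma WDC_graph_DC (v : E) (g h phi : E -> R) (w0 : E) (L e r : R) :
  enorm v = 1 -> convex_on setT g -> convex_on setT h ->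
  (forall x, h x <= g x) -> 0 <= L -> 0 < e -> 0 < r ->
  (forall w w', dotp w v = 0 -> dotp w' v = 0 -> `|phi w - phi w'| <= L * enorm (w - w')) ->
  dotp w0 v = 0 ->
  (forall x, enorm (x - (w0 + phi w0 *: v)) < r ->
     (g x = h x <-> dotp x v <= phi (hproj v x))) ->
  (forall x u, enorm (x - (w0 + phi w0 *: v)) < r -> 0 < g x - h x ->
     clarke_subgrad (fun x => g x - h x) x u -> e <= enorm u) ->
  exists2 r1 : R, 0 < r1 & exists p q : E -> R,
    [/\ convex_on setT p, convex_on setT q &
     forall w, dotp w v = 0 -> enorm (w - w0) < r1 -> phi w = p w - q w].
Proof.
move=> v1 cg ch hg L0 e0 r_gt0 lphi w0v Hr He.
set a := w0 + phi w0 *: v in Hr He.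
have [Lg Lg0 HLg] := convex_locally_lipschitz a cg.
have [Lh Lh0 HLh] := convex_locally_lipschitz a ch.
pose r2 := Num.min r 2^-1.
have r20 : 0 < r2 by rewrite lt_min r_gt0 invr_gt0 ltr0n.
have r2r : r2 <= r by rewrite ge_min lexx.
have r2h : r2 <= 2^-1 by rewrite ge_min lexx orbT.
have L1 : 0 < 1 + L by rewrite ltr_pwDl.
(* Over [D] the base point moves by less than [r1] and the graph height by at most [L * r1], in
   total at most [r2 / 4]; this leaves room for vertical shifts. *)
pose r1 := r2 / (4 * (1 + L)).
have r10 : 0 < r1 by rewrite divr_gt0 // mulr_gt0.
have r1E : r1 * (1 + L) = r2 / 4 by rewrite /r1; field; apply: lt0r_neq0.
have Lr1 : 0 <= L * r1 by rewrite mulr_ge0 // ltW.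
pose t0 := phi w0.
pose D := [set w : E | dotp w v = 0 /\ eball w0 r1 w].
have distB w t : enorm (w + t *: v - a) <= enorm (w - w0) + `|t - t0|.
  have -> : w + t *: v - a = (w - w0) + (t - t0) *: v.
    by apply/rowP => i; rewrite /a !mxE /t0; ring.
  by apply: le_trans (ler_enormD _ _) _; rewrite enormZ v1 mulr1.
have phiD w : D w -> `|phi w - t0| <= r2 / 4.
  move=> [wv]; rewrite /eball /= => wr; apply: le_trans (lphi _ _ wv w0v) _.
  by have := ler_wpM2l L0 (ltW wr); lra.
have inB w t : D w -> `|t - t0| <= r2 / 2 -> enorm (w + t *: v - a) < r2.
  by move=> [_]; rewrite /eball /= => wr tr; have := distB w t; lra.
have inb w t : D w -> `|t - t0| <= r2 / 4 -> enorm (w + t *: v - a) < r2 / 2.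
  by move=> [_]; rewrite /eball /= => wr tr; have := distB w t; lra.
pose f x := g x - h x.
have f0 x : 0 <= f x by rewrite subr_ge0.
have cf : continuous f.
  by move=> x; apply: (@continuousB _ _ _ g h);
    [exact: (convex_continuous cg)|exact: (convex_continuous ch)].
have f_eq0 w t : D w -> `|t - t0| <= r2 / 4 -> t <= phi w -> g (w + t *: v) = h (w + t *: v).
  move=> Dw tr tphi; have [wv _] := Dw; apply/Hr; first by have := inb w t Dw tr; lra.
  by rewrite dotp_graph // hproj_graph.
pose c := e / (2 * (1 + L)).
have c0 : 0 < c by rewrite divr_gt0 // mulr_gt0.
have growth w t : D w -> `|t - t0| <= r2 / 4 -> phi w <= t ->
    c * (t - phi w) <= f (w + t *: v).
  move=> Dw tr; rewrite le_eqVlt => /predU1P[<-|tphi].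
    by rewrite subrr mulr0.
  (* The graph has slope at most [L], so the ball of radius [dlt] about [w + t *: v] lies above it
     and [f > 0] there; the error bound [e * dlt / 2] equals [c * (t - phi w)]. *)
  have [wv _] := Dw; pose dlt := (t - phi w) / (1 + L).
  have dltE : dlt * (1 + L) = t - phi w by rewrite /dlt; field; apply: lt0r_neq0.
  have dlt0 : 0 < dlt by rewrite divr_gt0 // subr_gt0.
  have Ldlt : 0 <= L * dlt by rewrite mulr_ge0 // ltW.
  have xa := inb w t Dw tr; have := phiD w Dw.
  move: (tr); rewrite !ler_norml => /andP[tr1 tr2] /andP[ph1 ph2].
  have -> : c * (t - phi w) = e * dlt / 2 by rewrite /c /dlt; field; apply: lt0r_neq0.
  apply: (@error_bound _ _ f a e r) => //; first by lra.
  move=> y yx; rewrite lt_neqAle f0 andbT; apply/eqP => fy.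
  have ya : enorm (y - a) < r by have := ler_enorm_dist y (w + t *: v) a; lra.
  have /(Hr y ya) : g y = h y by apply/eqP; rewrite -subr_eq0 -/(f y) -fy.
  have := lphi _ _ (dotp_hproj v1 y) wv.
  have := enorm_hproj v1 (y - (w + t *: v)); rewrite -hprojB hproj_graph // => yw.
  have := dotp_le_enorm v1 (y - (w + t *: v)); rewrite dotpBl dotp_graph //.
  have := ler_wpM2l L0 (le_trans yw (ltW yx)).
  by rewrite !ler_norml => ? /andP[? ?] /andP[? ?]; lra.
(* One constant bounds the Lipschitz constants of [g] and [phi] and, through [h], the slopes at the
   kink. *)
pose M := Lg + Lh + L.
have M0 : 0 <= M by rewrite !addr_ge0.
have aB : eball a 2^-1 a by apply: eball_center; rewrite invr_gt0.
have Bh x : enorm (x - a) < r2 -> eball a 2^-1 x by rewrite /eball /=; lra.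
exists r1 => //.
have [] := @DC_of_kink _ _ v D g phi t0 (r2 / 4) (g a - Lg * r2) M c _ M0 c0 cg.
- move=> x y [xv xr] [yv yr] t t01; split; last exact: segment_closed_eball.
  by rewrite dotpDl !dotpZl xv yv !mulr0 addr0.
- move=> w w' t Dw Dw' tr.
  have tr' : `|t - t0| <= r2 / 2 by lra.
  have := HLg _ _ (Bh _ (inB w t Dw tr')) (Bh _ (inB w' t Dw' tr')).
  have -> : w + t *: v - (w' + t *: v) = w - w' by apply/rowP => i; rewrite !mxE; ring.
  move=> /le_trans; apply.
  by rewrite ler_wpM2r ?enorm_ge0 // /M; lra.
- move=> w t Dw tr; have wr := inb w t Dw tr.
  have {}wr : enorm (w + t *: v - a) < r2 by lra.
  have := HLg _ _ (Bh _ wr) aB; rewrite ler_norml => /andP[+ _].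
  have := ler_wpM2l Lg0 (ltW wr); lra.
- move=> w w' [wv _] [w'v _]; apply: le_trans (lphi _ _ wv w'v) _.
  by rewrite ler_wpM2r ?enorm_ge0 // /M; lra.
- exact: phiD.
- move=> w Dw; have ph := phiD w Dw.
  have cH (x y t : R) : 0 <= t <= 1 -> h (w + (t * x + (1 - t) * y) *: v) <=
      t * h (w + x *: v) + (1 - t) * h (w + y *: v).
    have -> : w + (t * x + (1 - t) * y) *: v =
        t *: (w + x *: v) + (1 - t) *: (w + y *: v).
      by apply/rowP => i; rewrite !mxE; ring.
    exact: ch.
  (* [s] is a subgradient of [h] along the line. Testing it at distance [r2 / 4] on both sides, with
     the Lipschitz bound on [h], gives [- M <= s <= M]. *)
  have [s Hs] := convex_subgradient cH (phi w); exists s.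
    have wB : eball a 2^-1 (w + phi w *: v) by apply/Bh/inB => //; lra.
    have slope t : `|t - phi w| = r2 / 4 -> s * (t - phi w) <= M * (r2 / 4).
      move=> tE; have tB : eball a 2^-1 (w + t *: v).
        apply/Bh/inB => //.
        have -> : t - t0 = (t - phi w) + (phi w - t0) by ring.
        by apply: le_trans (ler_normD _ _) _; lra.
      have := HLh _ _ tB wB.
      have -> : w + t *: v - (w + phi w *: v) = (t - phi w) *: v.
        by apply/rowP => i; rewrite !mxE; ring.
      rewrite enormZ v1 mulr1 tE => /(le_trans (ler_norm _)).
      have : Lh * (r2 / 4) <= M * (r2 / 4) by rewrite ler_pM2r ?divr_gt0 // /M; lra.
      by have := Hs t; lra.
    have r4 : 0 < r2 / 4 by rewrite divr_gt0.
    have := slope (phi w + r2 / 4); rewrite (addrC (phi w)) addrK gtr0_norm // => /(_ erefl).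
    rewrite ler_pM2r // => ->; rewrite andbT.
    have := slope (phi w - r2 / 4).
    have -> : phi w - r2 / 4 - phi w = - (r2 / 4) by ring.
    by rewrite normrN gtr0_norm // => /(_ erefl); rewrite mulrN -mulNr ler_pM2r //; lra.
  (* Below the graph [g = h] and [t - phi w <= 0], so a slope [s'] larger than [s] only lowers the
     line; above it, the growth [c * (t - phi w)] pays for [s' - s <= c]. *)
  move=> s' /andP[ss' s'c] t tr.
  have gh : g (w + phi w *: v) = h (w + phi w *: v) by exact: f_eq0.
  have := Hs t; rewrite gh.
  have [tphi|tphi] := leP t (phi w).
    by rewrite (f_eq0 w t) //; nra.
  by have := growth w t Dw tr (ltW tphi); rewrite /f; nra.
move=> p [q [cp cq pq]]; exists p, q; split=> // w wv wr.
by apply: pq.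
Qed.

End Graph.

(** * The two implications *)

Section Main.
Variables (R : realType) (d : nat).
Notation E := 'rV[R]_d.
Implicit Types (A : set E) (a : E).

(** Serves the interior points of the domain. The zero function is never positive, so regularity
    holds vacuously. *)
Lemma WDC_setT : WDC [set: E].
Proof.
exists (fun=> 0); split.
- exists (fun=> 0), (fun=> 0).
  by split=> [x y _ _ t _|x y _ _ t _|x _]; rewrite ?mulr0 ?addr0 ?subrr.
- by [].
- by apply/seteqP; split.
- by move=> x xs us _ _ /(_ 0%N); rewrite ltxx.
Qed.

Lemma closed_DC_domain_locally_WDC A : closed_DC_domain A -> locally_WDC A.
Proof.
move=> [_ HA] a Aa; have [iA|niA] := pselect (interior A a).
  exists setT; split; first exact: WDC_setT.
  exists (interior A); split=> //; first exact: open_interior.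
  by rewrite setTI; apply/setIidPr; exact: interior_subset.
have [r [W [v [phi [r0 rkW [v1 Wv] DCphi chart]]]]] :=
  HA a (conj (@subset_closure _ A a Aa) niA).
exists (subgraph W v phi); split; first exact: subgraph_WDC.
by exists (eball a r); split; [exact: open_eball|exact: eball_center|].
Qed.

(** If [a] were strictly below the graph, the Lipschitz bound would put a whole ball about [a] below
    it, making [a] interior. *)
Lemma chart_center A a (r L : R) (v : E) (phi : E -> R) :
  enorm v = 1 -> 0 < r -> 0 <= L ->
  (forall w w', dotp w v = 0 -> dotp w' v = 0 -> `|phi w - phi w'| <= L * enorm (w - w')) ->
  (forall x, enorm (x - a) < r -> (A x <-> dotp x v <= phi (hproj v x))) ->
  A a -> ~ interior A a -> dotp a v = phi (hproj v a).
Proof.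
move=> v1 r0 L0 lphi HA Aa niA.
have aphi : dotp a v <= phi (hproj v a) by apply/HA => //; rewrite subrr enorm0.
apply/eqP; rewrite eq_le aphi leNgt; apply/negP => lt_phi; apply: niA.
pose gap := phi (hproj v a) - dotp a v.
have gap0 : 0 < gap by rewrite subr_gt0.
pose s := Num.min r (gap / (1 + L)).
have L1 : 0 < 1 + L by rewrite ltr_pwDl.
have s0 : 0 < s by rewrite lt_min r0 divr_gt0.
suff sA : eball a s `<=` A.
  by apply: (filterS sA); apply: open_nbhs_nbhs; split; [exact: open_eball|exact: eball_center].
move=> x; rewrite /eball /= lt_min ltr_pdivlMr // => /andP[xr xs]; apply/HA => //.
have := lphi _ _ (dotp_hproj v1 x) (dotp_hproj v1 a); rewrite hprojB.
have := ler_wpM2l L0 (enorm_hproj v1 (x - a)).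
have := dotp_le_enorm v1 (x - a); rewrite dotpBl !ler_norml /gap in xs *.
by move=> /andP[? ?] ? /andP[? ?]; lra.
Qed.

Lemma locally_WDC_closed_DC_domain A :
  closed_Lipschitz_domain A -> locally_WDC A -> closed_DC_domain A.
Proof.
move=> [clA HA] wA; split=> // a bda; have [clAa niA] := bda.
have Aa : A a by apply: clA.
have [r [W [v [phi [r0 rkW [v1 Wv] /lipschitz_onP [L L0 lphi] chart]]]]] := HA a bda.
have memW w : (w <= W)%MS <-> dotp w v = 0 by apply: mem_hyperplane.
have lphi' w w' : dotp w v = 0 -> dotp w' v = 0 ->
    `|phi w - phi w'| <= L * enorm (w - w').
  by move=> wv w'v; apply: lphi; apply/memW.
have inter (S T : set E) U x : S `&` U = T `&` U -> U x -> S x <-> T x.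
  move=> ST Ux; split=> H.
    by have [] : (T `&` U) x by rewrite -ST.
  by have [] : (S `&` U) x by rewrite ST.
have chartA x : enorm (x - a) < r -> (A x <-> dotp x v <= phi (hproj v x)).
  move=> xr; rewrite -(subgraphE v1 rkW Wv); exact: (inter _ _ _ _ chart).
have [B [[f [[g [h [cg ch fE]]] f0 BE reg]] [U [oU Ua ABU]]]] := wA a Aa.
have [r2 r20 r2U] := open_eball_sub oU Ua.
have fA x : U x -> (f x = 0 <-> A x).
  by move=> Ux; rewrite (inter _ _ _ _ ABU Ux) BE.
have fa : f a = 0 by apply/fA.
have [e [r3 [e0 r30 He]]] := weakly_regular_uniform reg fa.
have {}fE : f = fun x => g x - h x by apply/funext => x; exact: fE.
pose w0 := hproj v a.
have aphi : dotp a v = phi w0 by exact: (chart_center v1 r0 L0 lphi' chartA Aa niA).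
have aE : w0 + phi w0 *: v = a by rewrite -aphi hprojK.
pose s := Num.min r (Num.min r2 r3).
have s0 : 0 < s by rewrite !lt_min r0 r20.
have hg x : h x <= g x by have := f0 x; rewrite fE subr_ge0.
have Hr x : enorm (x - (w0 + phi w0 *: v)) < s -> (g x = h x <-> dotp x v <= phi (hproj v x)).
  rewrite aE /s !lt_min => /and3P[xr xr2 _].
  rewrite -chartA // -fA; last exact: r2U.
  by rewrite fE; split=> [->|/eqP]; rewrite ?subrr // subr_eq0 => /eqP.
have {}He x u : enorm (x - (w0 + phi w0 *: v)) < s -> 0 < g x - h x ->
    clarke_subgrad (fun x => g x - h x) x u -> e <= enorm u.
  by rewrite aE -fE /s !lt_min => /and3P[_ _ xr3]; have := He x u xr3; rewrite fE.
have [r1 r10 [p [q [cp cq pq]]]] :=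
  WDC_graph_DC v1 cg ch hg L0 e0 s0 lphi' (dotp_hproj v1 a) Hr He.
(* The chart keeps [W] and [v]. Projection does not increase distances, so [p - q] agrees with [phi]
   at the projections of all points within [r1] of [a]. *)
exists (Num.min r r1), W, v, (fun w => p w - q w); split=> //.
- by rewrite lt_min r0.
- by exists p, q; split=> // x y _ _; [exact: cp|exact: cq].
have phiE x : enorm (x - a) < r1 -> phi (hproj v x) = p (hproj v x) - q (hproj v x).
  move=> xr1; apply: pq; first exact: dotp_hproj.
  by rewrite hprojB; exact: le_lt_trans (enorm_hproj v1 _) xr1.
apply/seteqP; split=> x [Hx xs]; split=> //;
    move: xs; rewrite /eball /= lt_min => /andP[xr xr1].
  by apply/(subgraphE v1 rkW Wv); rewrite -phiE //; apply/chartA.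
by move/(subgraphE v1 rkW Wv): Hx => Hx; apply/chartA => //; rewrite phiE.
Qed.

End Main.

Theorem theorem6p10 (R : realType) (d : nat) (A : set 'rV[R]_d) :
  closed_Lipschitz_domain A -> (locally_WDC A <-> closed_DC_domain A).
Proof.
move=> lipA; split; first exact: locally_WDC_closed_DC_domain.
exact: closed_DC_domain_locally_WDC.
Qed.
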